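(* Let $p\in\mathbb{C}\setminus\{0\}$, $N\in\mathbb{N}$, $\mu\in\mathbb{C}$ and $x\in\{0,1,2,\dots\}$. Then the fractional Krawtchouk function $K_\mu(x;p,N)$ satisfies $$K_\mu(x;p,N)=\frac{\Gamma(N-x+1)\,\Gamma(N-\mu+1)}{\Gamma(N+1)\,\Gamma(N-\mu-x+1)}\sum_{j=0}^{x}\frac{(-\mu)_j(-x)_j}{j!\,(N-\mu-x+1)_j}\left(1-\frac1p\right)^j .$$
   Context: For integer index $j\ge0$, $(z)_0=1$ and $(z)_j=z(z+1)\cdots(z+j-1)$. $\Gamma$ is the Gamma function. For $z\in\mathbb{C}$ and integer $k\ge0$, $\binom{z}{k}=\frac{z(z-1)\cdots(z-k+1)}{k!}$. Gray--Zhang fractional difference: for $\mu\in\mathbb{C}$, an integer $b$ and an integer $t\ge b$, the $\mu$-th order difference of $f$ over $\{b,b+1,\dots,t\}$ is $$\nabla_{b,t}^{\mu}f(t)=\frac{1}{\Gamma(n-\mu)}\nabla^n\left[\sum_{k=b}^{t}(t-k+1)_{n-\mu-1}f(k)\right],$$ where $n=\max\{0,n_0\}$, $n_0$ is the integer with $0<\mathrm{Re}(n_0-\mu)\le1$, $\nabla g(t)=g(t)-g(t-1)$ acts on the bracket as a function of $t$ (a sum with upper limit smaller than $b$ being $0$), and for complex index $s$, $(z)_s=\Gamma(z+s)/\Gamma(z)$ when $z$ and $z+s$ are not in $\{0,-1,-2,\dots\}$. The fractional Krawtchouk function is defined, for $p\in\mathbb{C}\setminus\{0\}$, $N\in\mathbb{N}$,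 $\mu\in\mathbb{C}$ and $x\in\{0,1,2,\dots\}$, by $$K_\mu(x;p,N)=\frac{1}{\binom{N}{x}\left(\frac{p}{1-p}\right)^x}\,\nabla_{0,x}^{\mu}\left[\binom{N-\mu}{x}\left(\frac{p}{1-p}\right)^x\right],$$ i.e. using the $\mu$-th order difference over $\{0,1,\dots,x\}$ of the function $k\mapsto\binom{N-\mu}{k}\left(\frac{p}{1-p}\right)^k$, evaluated at $x$.
   Formalization: p = 1 is excluded, since p/(1-p) is undefined there; where N-μ-x+1 is in {0,-1,-2,...} the right side is undefined (e.g. μ = N, x = 1) and is read as its limit in μ; for x > N, where neither side is defined, both are taken to be 0. *)

(* Defs.v *)
From Stdlib Require Import Reals ZArith Arith.
From Coquelicot Require Import Coquelicot.

Local Open Scope C_scope.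

Fixpoint rising (z : C) (j : nat) : C :=
  match j with
  | O => 1
  | S i => rising z i * (z + INR i)
  end.

Fixpoint falling (z : C) (k : nat) : C :=
  match k with
  | O => 1
  | S i => falling z i * (z - INR i)
  end.

Definition Cbinom (z : C) (k : nat) : C := falling z k / INR (fact k).

(* a ^ z = exp (z ln a), for real a > 0 and complex z. *)
Definition Rpow_C (a : R) (z : C) : C :=
  RtoC (exp (Re z * ln a)) * (cos (Im z * ln a), sin (Im z * ln a)).

(* Gauss's product formula
     Gamma(z) = lim_m  m! m^z / (z (z+1) ... (z+m)),
   which converges for every z outside {0,-1,-2,...}; the limit is taken on
   real and imaginary parts.  At a pole the terms are eventually a division
   by 0, so that CGamma has the value 0 there. *)
Definition Gauss_seq (z : C) (m : nat) : C :=
  INR (fact m) * Rpow_C (INR m) z / rising z (S m).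

Definition CGamma (z : C) : C :=
  (real (Lim_seq (fun m => Re (Gauss_seq z m))),
   real (Lim_seq (fun m => Im (Gauss_seq z m)))).

(* (z)_s for a complex index s. *)
Definition risingC (z s : C) : C := CGamma (z + s) / CGamma z.

Definition nabla (g : Z -> C) : Z -> C := fun t => g t - g (t - 1)%Z.

(* sum_{k=b}^{t} F k, equal to 0 when t < b. *)
Definition sumZ (b t : Z) (F : Z -> C) : C :=
  if Z_lt_dec t b then 0
  else sum_n (fun i => F (b + Z.of_nat i)%Z) (Z.to_nat (t - b)).

(* [up r] is the unique integer with 0 < up r - r <= 1 (see [archimed]), so
   up (Re mu) is n_0, and Z.to_nat truncates negative integers to 0. *)
Definition diff_order (mu : C) : nat := Z.to_nat (up (Re mu)).

(* The kernel (s-k+1)_{n-mu-1} is always taken with its complex index: here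
   s-k+1 >= 1 and Re (n-mu) > 0, so neither Gamma factor is at a pole, and the
   value agrees with [rising] when n-mu-1 is a natural number. *)
Definition frac_diff (mu : C) (b : Z) (f : Z -> C) (t : Z) : C :=
  let n := diff_order mu in
  / CGamma (INR n - mu) *
  Nat.iter n nabla
    (fun s => sumZ b s (fun k =>
       risingC (IZR (s - k + 1)) (INR n - mu - 1) * f k)) t.

(* The summation variable runs over {0,...,x}, where Z.to_nat is exact. *)
Definition frac_krawtchouk (mu : C) (x : nat) (p : C) (N : nat) : C :=
  / (Cbinom (INR N) x * (p / (1 - p)) ^ x) *
  frac_diff mu 0
    (fun k => Cbinom (INR N - mu) (Z.to_nat k) * (p / (1 - p)) ^ Z.to_nat k)
    (Z.of_nat x).

(* Main.v *)
Require Import Defs.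
From Stdlib Require Import Reals ZArith Lra Lia.
From Coquelicot Require Import Coquelicot.

Local Open Scope C_scope.

(** In terms of generating functions, the backward difference over {0,1,...} is
    multiplication by 1 - u, while the sum with kernel (t-k+1)_(a-1) / Gamma(a) is
    multiplication by (1 - u)^(-a), whose coefficients are (a)_j / j!.  Applying n
    differences to the sum of order a = n - mu therefore gives multiplication by
    (1 - u)^mu, whatever n is ([frac_diff_neg_binom_conv]).  Evaluated on
    binom(N - mu, k) (p/(1-p))^k, this yields

      K_mu(x) = 1/binom(N,x) sum_j (-mu)_j / j! binom(N - mu, x - j) ((1-p)/p)^j,

    a polynomial in mu ([frac_krawtchouk_poly]).  The hypergeometric expression has
    the same value wherever w = N - mu - x + 1 is not a pole of Gamma, term by
    term, because Gamma(w + x) / Gamma(w) = (w)_x and (w)_x / (w)_j is a falling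
    factorial of N - mu ([krawtchouk_hyp_poly]).  At the remaining orders, which
    are isolated ([nonpole_near]), the limit is the value of the polynomial, by
    continuity ([continuous_krawtchouk_poly]).

    What is used about Gamma is the functional equation ([CGamma_S]), the values at
    positive integers and at poles, and the fact that Gamma has no zero.  All of
    this rests on the convergence of Gauss's product to a nonzero limit
    ([Gauss_seq_cv]): successive ratios of its terms are 1 + O(1/m^2)
    ([Gauss_ratio_bound]), and a product with such factors converges together with
    its reciprocal ([product_cv_nonzero]). *)

(** * Convergence of complex sequences and infinite products *)

(** Componentwise convergence, because the Gamma function is defined from the
    separate limits of the real and imaginary parts. *)
Definition Clim (u : nat -> C) (l : C) : Prop :=
  is_lim_seq (fun n => Re (u n)) (Re l) /\ is_lim_seq (fun n => Im (u n)) (Im l).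

Lemma Clim_mult u v a b : Clim u a -> Clim v b -> Clim (fun n => u n * v n) (a * b).
Proof.
  intros [Hu1 Hu2] [Hv1 Hv2]; split; simpl.
  - apply (is_lim_seq_minus' (fun n => Re (u n) * Re (v n))%R (fun n => Im (u n) * Im (v n))%R);
      now apply is_lim_seq_mult'.
  - apply (is_lim_seq_plus' (fun n => Re (u n) * Im (v n))%R (fun n => Im (u n) * Re (v n))%R);
      now apply is_lim_seq_mult'.
Qed.

Lemma Clim_unique u a b : Clim u a -> Clim u b -> a = b.
Proof.
  intros [H1 H2] [H3 H4].
  apply is_lim_seq_unique in H1, H2, H3, H4.
  rewrite H1 in H3; rewrite H2 in H4.
  injection H3; injection H4; intros E1 E2.
  destruct a, b; simpl in *; now subst.
Qed.

Lemma Clim_ext_loc u v l : eventually (fun n => u n = v n) -> Clim u l -> Clim v l.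
Proof.
  intros [N HN] [H1 H2]; split.
  - apply is_lim_seq_ext_loc with (2 := H1); exists N; intros n Hn; now rewrite (HN n Hn).
  - apply is_lim_seq_ext_loc with (2 := H2); exists N; intros n Hn; now rewrite (HN n Hn).
Qed.

Lemma Clim_shift u M l : Clim (fun n => u (n + M)%nat) l <-> Clim u l.
Proof.
  unfold Clim.
  rewrite (is_lim_seq_incr_n (fun n => Re (u n)) M (Re l)).
  rewrite (is_lim_seq_incr_n (fun n => Im (u n)) M (Im l)).
  reflexivity.
Qed.

Lemma Clim_const c : Clim (fun _ => c) c.
Proof. split; apply is_lim_seq_const. Qed.

Lemma im_le_Cmod c : (Rabs (Im c) <= Cmod c)%R.
Proof. eapply Rle_trans; [apply Rmax_r | apply (Rmax_Cmod c)]. Qed.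

Lemma Cmod_le_parts c : (Cmod c <= Rabs (Re c) + Rabs (Im c))%R.
Proof.
  assert (E : c = RtoC (Re c) + Ci * RtoC (Im c)).
  { destruct c as [a b]; unfold Ci, RtoC, Cplus, Cmult; simpl; f_equal; ring. }
  rewrite E at 1.
  eapply Rle_trans; [apply Cmod_triangle |].
  rewrite Cmod_mult, Cmod_Ci, !Cmod_R; lra.
Qed.

(** The increments of [w] are dominated by those of the convergent sequence
    [- B * s], so [w - B * s] is increasing and bounded above; [w] is the sum of
    two monotone bounded sequences. *)
Lemma bounded_variation_cv (w s : nat -> R) (B : R) :
  (0 <= B)%R -> (forall n, 0 <= s n)%R ->
  (forall n, Rabs (w (S n) - w n) <= B * (s n - s (S n)))%R ->
  (forall n, w n <= B)%R ->
  (forall n, s (S n) <= s n)%R ->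
  ex_finite_lim_seq w.
Proof.
  intros HB Hs Hv Hw Hd.
  destruct (ex_finite_lim_seq_decr s 0%R Hd Hs) as [ls Hls].
  destruct (ex_finite_lim_seq_incr (fun n => w n - B * s n)%R B) as [lu Hlu].
  - intros n; specialize (Hv n); apply Rabs_le_between in Hv; lra.
  - intros n; specialize (Hw n); pose proof (Rmult_le_pos _ _ HB (Hs n)); lra.
  - exists (lu + B * ls)%R.
    apply is_lim_seq_ext with (fun n => (w n - B * s n) + B * s n)%R; [intros; ring |].
    apply is_lim_seq_plus'; [exact Hlu |].
    apply is_lim_seq_mult'; [apply is_lim_seq_const | exact Hls].
Qed.

(** Infinite products whose factors [a (S n) / a n] differ from 1 by at most a
    telescoping amount [s n - s (S n)].  Since [1 + d <= exp d], the quantity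
    [Cmod (a n) * exp (s n)] decreases; hence [a] is bounded, and the hypothesis
    becomes an additive bound on the increments of [a]. *)
Lemma product_cv (a : nat -> C) (s : nat -> R) :
  (forall n, 0 <= s n)%R -> (forall n, s (S n) <= s n)%R ->
  (forall n, Cmod (a (S n) - a n) <= (s n - s (S n)) * Cmod (a n))%R ->
  exists l, Clim a l.
Proof.
  intros Hs Hd Ha.
  set (B := (Cmod (a O) * exp (s O))%R).
  assert (HB0 : (0 <= B)%R).
  { apply Rmult_le_pos; [apply Cmod_ge_0 | left; apply exp_pos]. }
  assert (Hdecr : forall n, (Cmod (a n) * exp (s n) <= B)%R).
  { induction n as [|n IH]; [apply Rle_refl |].
    eapply Rle_trans; [| exact IH].
    assert (H1 : (Cmod (a (S n)) <= (1 + (s n - s (S n))) * Cmod (a n))%R).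
    { replace (a (S n)) with (a n + (a (S n) - a n)) by ring.
      eapply Rle_trans; [apply Cmod_triangle |]. specialize (Ha n); lra. }
    replace (exp (s n)) with (exp (s n - s (S n)) * exp (s (S n)))%R
      by (rewrite <- exp_plus; f_equal; ring).
    rewrite <- Rmult_assoc. apply Rmult_le_compat_r; [left; apply exp_pos |].
    eapply Rle_trans; [exact H1 |]. rewrite Rmult_comm.
    apply Rmult_le_compat_l; [apply Cmod_ge_0 |].
    apply exp_ineq1_le. }
  assert (HB : forall n, (Cmod (a n) <= B)%R).
  { intros n; eapply Rle_trans; [| exact (Hdecr n)].
    rewrite <- (Rmult_1_r (Cmod (a n))) at 1.
    apply Rmult_le_compat_l; [apply Cmod_ge_0 |].
    pose proof (exp_ineq1_le (s n)); specialize (Hs n); lra. }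
  assert (Hv : forall n, (Cmod (a (S n) - a n) <= B * (s n - s (S n)))%R).
  { intros n; eapply Rle_trans; [apply Ha |]. rewrite Rmult_comm.
    apply Rmult_le_compat_r; [specialize (Hd n); lra | apply HB]. }
  destruct (bounded_variation_cv (fun n => Re (a n)) s B) as [l1 H1]; trivial.
  - intros n; eapply Rle_trans; [| apply (Hv n)].
    replace (Re (a (S n)) - Re (a n))%R with (Re (a (S n) - a n)) by reflexivity.
    apply re_le_Cmod.
  - intros n; eapply Rle_trans; [apply Rle_abs |].
    eapply Rle_trans; [apply re_le_Cmod | apply HB].
  - destruct (bounded_variation_cv (fun n => Im (a n)) s B) as [l2 H2]; trivial.
    + intros n; eapply Rle_trans; [| apply (Hv n)].
      replace (Im (a (S n)) - Im (a n))%R with (Im (a (S n) - a n)) by reflexivity.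
      apply im_le_Cmod.
    + intros n; eapply Rle_trans; [apply Rle_abs |].
      eapply Rle_trans; [apply im_le_Cmod | apply HB].
    + exists (l1, l2); split; assumption.
Qed.

(** The reciprocals satisfy the same kind of estimate with the constant doubled,
    as the factors stay away from 0; so both products converge, and their
    limits have product 1. *)
Lemma product_cv_nonzero (a : nat -> C) (s : nat -> R) :
  (forall n, 0 <= s n <= / 2)%R -> (forall n, s (S n) <= s n)%R ->
  (forall n, Cmod (a (S n) - a n) <= (s n - s (S n)) * Cmod (a n))%R ->
  (forall n, a n <> 0) ->
  exists l : C, l <> 0 /\ Clim (fun n => / a n) l.
Proof.
  intros Hs Hd Ha Hnz.
  destruct (product_cv a s) as [l Hl]; trivial; [intros; apply Hs |].
  destruct (product_cv (fun n => / a n) (fun n => 2 * s n)%R) as [l' Hl'].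
  - intros n; specialize (Hs n); lra.
  - intros n; specialize (Hd n); lra.
  - intros n. specialize (Ha n).
    set (d := (s n - s (S n))%R) in *.
    assert (Hdd : (0 <= d <= / 2)%R).
    { pose proof (Hs n); pose proof (Hs (S n)); specialize (Hd n); unfold d; lra. }
    assert (P0 := proj1 (Cmod_gt_0 _) (Hnz n)).
    assert (P1 := proj1 (Cmod_gt_0 _) (Hnz (S n))).
    replace (/ a (S n) - / a n) with (- (a (S n) - a n) / (a n * a (S n)))
      by (field; split; apply Hnz).
    rewrite Cmod_div, Cmod_opp, Cmod_mult by (apply Cmult_neq_0; apply Hnz).
    rewrite Cmod_inv by apply Hnz.
    replace (2 * s n - 2 * s (S n))%R with (2 * d)%R by (unfold d; ring).
    set (A := Cmod (a n)) in *. set (A' := Cmod (a (S n))) in *.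
    assert (HA : (A <= 2 * A')%R).
    { assert (A <= A' + d * A)%R.
      { eapply Rle_trans with (A' + Cmod (a (S n) - a n))%R; [| lra].
        unfold A, A'. rewrite <- (Cmod_opp (a (S n) - a n)).
        eapply Rle_trans; [| apply Cmod_triangle]. right; f_equal; ring. }
      nra. }
    apply Rmult_le_reg_r with (A * A')%R; [nra |].
    unfold Rdiv; rewrite Rmult_assoc, Rinv_l, Rmult_1_r by nra.
    replace (2 * d * / A * (A * A'))%R with (d * (2 * A'))%R by (field; lra).
    eapply Rle_trans; [exact Ha |]. apply Rmult_le_compat_l; lra.
  - exists l'; split; [| exact Hl'].
    intros E.
    assert (H := Clim_mult _ _ _ _ Hl Hl').
    rewrite E, Cmult_0_r in H.
    apply (C1_nz), (Clim_unique (fun n => a n * / a n)); [| exact H].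
    apply Clim_ext_loc with (fun _ => RtoC 1); [| apply Clim_const].
    exists O; intros n _; symmetry; apply Cinv_r, Hnz.
Qed.

(** * Gauss's product for the Gamma function *)

Definition nonpole (z : C) : Prop := forall m : nat, z <> - INR m.

Lemma CINR_S n : RtoC (INR (S n)) = INR n + 1.
Proof. now rewrite S_INR, RtoC_plus. Qed.

Lemma nonpole_add z n : nonpole z -> z + INR n <> 0.
Proof. intros H E; apply (H n). rewrite <- (Cplus_0_l (- INR n)), <- E; ring. Qed.

Lemma rising_nonzero z n : nonpole z -> rising z n <> 0.
Proof.
  intros H; induction n as [|n IH]; simpl; [apply C1_nz |].
  now apply Cmult_neq_0; [| apply nonpole_add].
Qed.

Lemma rising_head z n : rising z (S n) = z * rising (z + 1) n.
Proof.
  induction n as [|n IH]; [simpl; ring |].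
  change (rising z (S n) * (z + INR (S n)) = z * (rising (z + 1) n * (z + 1 + INR n))).
  rewrite IH, CINR_S; ring.
Qed.

Lemma CINR_S_nonzero n : RtoC (INR (S n)) <> 0.
Proof. intros E; apply RtoC_inj in E; revert E; apply not_0_INR; lia. Qed.

Lemma CINR_fact_nonzero n : RtoC (INR (fact n)) <> 0.
Proof. intros E; apply RtoC_inj in E; now apply (INR_fact_neq_0 n). Qed.

Lemma Rpow_C_mult a b z : (0 < a)%R -> (0 < b)%R -> Rpow_C (a * b) z = Rpow_C a z * Rpow_C b z.
Proof.
  intros Ha Hb; unfold Rpow_C. rewrite ln_mult, !Rmult_plus_distr_l by assumption.
  rewrite exp_plus, cos_plus, sin_plus.
  unfold RtoC, Cmult; simpl; f_equal; ring.
Qed.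

Lemma Rpow_C_plus a y z : Rpow_C a (y + z) = Rpow_C a y * Rpow_C a z.
Proof.
  unfold Rpow_C.
  replace (Re (y + z) * ln a)%R with (Re y * ln a + Re z * ln a)%R by (simpl; unfold Re; ring).
  replace (Im (y + z) * ln a)%R with (Im y * ln a + Im z * ln a)%R by (simpl; unfold Im; ring).
  rewrite exp_plus, cos_plus, sin_plus.
  unfold RtoC, Cmult; simpl; f_equal; ring.
Qed.

Lemma Rpow_C_0 a : Rpow_C a 0 = 1.
Proof.
  unfold Rpow_C; simpl. rewrite Rmult_0_l, exp_0, cos_0, sin_0.
  unfold RtoC, Cmult; simpl; f_equal; ring.
Qed.

Lemma Rpow_C_1 a : (0 < a)%R -> Rpow_C a 1 = a.
Proof.
  intros Ha; unfold Rpow_C; simpl. rewrite Rmult_0_l, Rmult_1_l, exp_ln, cos_0, sin_0 by assumption.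
  unfold RtoC, Cmult; simpl; f_equal; ring.
Qed.

Lemma Rpow_C_opp a z : Rpow_C a z * Rpow_C a (- z) = 1.
Proof. rewrite <- Rpow_C_plus, Cplus_opp_r; apply Rpow_C_0. Qed.

Lemma Rpow_C_nonzero a z : Rpow_C a z <> 0.
Proof. intros E; generalize (Rpow_C_opp a z); rewrite E, Cmult_0_l; intros H; symmetry in H; now apply C1_nz. Qed.

Lemma exp_bounds a : (Rabs a <= / 2)%R -> (0 <= exp a - 1 - a <= 2 * a ^ 2)%R.
Proof.
  intros H; apply Rabs_le_between in H.
  pose proof (exp_ineq1_le a); pose proof (exp_ineq1_le (- a)).
  assert (E : (exp a * exp (- a) = 1)%R) by (rewrite <- exp_plus, Rplus_opp_r; apply exp_0).
  pose proof (exp_pos a).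
  split; [lra |].
  assert (exp a * (1 - a) <= 1)%R by nra.
  assert (1 <= (1 + a + 2 * a ^ 2) * (1 - a))%R by nra.
  assert (exp a <= 1 + a + 2 * a ^ 2)%R; [| lra].
  apply Rmult_le_reg_r with (1 - a)%R; lra.
Qed.

Lemma cos_bounds b : (0 <= 1 - cos b <= b ^ 2 / 2)%R.
Proof.
  split; [pose proof (COS_bound b); lra |].
  replace b with (2 * (b / 2))%R at 1 by field.
  rewrite cos_2a_sin.
  assert (Rabs (sin (b / 2)) <= Rabs (b / 2))%R.
  { destruct (MVT_gen sin 0 (b / 2) cos) as [c [_ Hc]].
    - intros; apply is_derive_Reals, derivable_pt_lim_sin.
    - intros; apply continuity_pt_filterlim, continuous_sin.
    - rewrite sin_0, !Rminus_0_r in Hc; rewrite Hc, Rabs_mult.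
      rewrite <- (Rmult_1_l (Rabs (b / 2))) at 2.
      apply Rmult_le_compat_r; [apply Rabs_pos |].
      apply Rabs_le, COS_bound. }
  apply Rsqr_le_abs_1 in H; unfold Rsqr in H; nra.
Qed.

Lemma sin_bounds b : (Rabs b <= 1)%R -> (Rabs (sin b - b) <= b ^ 2)%R.
Proof.
  intros Hb.
  destruct (MVT_gen sin 0 b cos) as [c [Hc1 Hc]].
  - intros; apply is_derive_Reals, derivable_pt_lim_sin.
  - intros; apply continuity_pt_filterlim, continuous_sin.
  - rewrite sin_0, !Rminus_0_r in Hc.
    assert (Hcb : (c ^ 2 <= b ^ 2)%R).
    { unfold Rmin, Rmax in Hc1; destruct (Rle_dec 0 b); nra. }
    rewrite Hc. replace (cos c * b - b)%R with (- ((1 - cos c) * b))%R by ring.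
    pose proof (cos_bounds c).
    rewrite Rabs_Ropp, Rabs_mult, (Rabs_pos_eq (1 - cos c)) by lra.
    pose proof (Rabs_pos b). nra.
Qed.

(** First-order Taylor estimate of the complex exponential, here in the real
    coordinates used by [Rpow_C]. *)
Lemma cexp_linear (w : C) : (Cmod w <= / 2)%R ->
  (Cmod (RtoC (exp (Re w)) * (cos (Im w), sin (Im w)) - (1 + w)) <= 8 * Cmod w ^ 2)%R.
Proof.
  intros Hw.
  assert (Ha := re_le_Cmod w). assert (Hb := im_le_Cmod w).
  set (r := Cmod w) in *. destruct w as [a b]; simpl in Ha, Hb |- *.
  assert (Hr : (0 <= r)%R) by (pose proof (Rabs_pos a); lra).
  eapply Rle_trans; [apply Cmod_le_parts |]; simpl.
  assert (Ha2 : (a ^ 2 <= r ^ 2)%R) by (rewrite <- pow2_abs; apply pow_incr; split; [apply Rabs_pos | exact Ha]).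
  assert (Hb2 : (b ^ 2 <= r ^ 2)%R) by (rewrite <- (pow2_abs b); apply pow_incr; split; [apply Rabs_pos | exact Hb]).
  assert (He := exp_bounds a ltac:(lra)).
  assert (Hc := cos_bounds b).
  assert (Hs := sin_bounds b ltac:(lra)).
  set (e := exp a) in *. set (c := cos b) in *. set (s := sin b) in *.
  apply Rabs_le_between in Ha. apply Rabs_le_between in Hb. apply Rabs_le_between in Hs.
  assert (He2 : (0 <= e <= 2)%R) by (unfold e in *; pose proof (exp_pos a); nra).
  assert (H1 : (Rabs (e * c - 0 * s + - (1 + a)) <= 4 * r ^ 2)%R).
  { apply Rabs_le.
    replace (e * c - 0 * s + - (1 + a))%R with ((e - 1 - a) - e * (1 - c))%R by ring.
    assert (0 <= e * (1 - c) <= r ^ 2)%R by nra. lra. }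
  assert (H2 : (Rabs (e * s + 0 * c + - (0 + b)) <= 4 * r ^ 2)%R).
  { replace (e * s + 0 * c + - (0 + b))%R with (e * (s - b) + (e - 1) * b)%R by ring.
    eapply Rle_trans; [apply Rabs_triang |].
    rewrite !Rabs_mult.
    assert (Rabs e <= 2)%R by (apply Rabs_le; lra).
    assert (Rabs (s - b) <= r ^ 2)%R by (apply Rabs_le; lra).
    assert (Rabs (e - 1) <= 2 * r)%R by (apply Rabs_le; nra).
    assert (Rabs b <= r)%R by (apply Rabs_le; lra).
    pose proof (Rabs_pos e); pose proof (Rabs_pos (s - b)); pose proof (Rabs_pos (e - 1)); pose proof (Rabs_pos b).
    nra. }
  lra.
Qed.

(** The expansion (1 + t)^z = 1 + z t + O(t^2), from [cexp_linear] and
    t - t^2 <= ln (1 + t) <= t. *)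
Lemma Rpow_C_linear z (t : R) :
  (0 < t)%R -> (Cmod z * t <= / 2)%R ->
  (Cmod (Rpow_C (1 + t) z - (1 + z * t)) <= (8 * Cmod z ^ 2 + Cmod z) * t ^ 2)%R.
Proof.
  intros Ht Hz.
  set (L := ln (1 + t)).
  assert (HL : (t - t ^ 2 <= L <= t)%R).
  { split.
    - unfold L. rewrite <- (Rinv_inv (1 + t)), ln_Rinv by (apply Rinv_0_lt_compat; lra).
      assert (ln (/ (1 + t)) <= / (1 + t) - 1)%R.
      { rewrite <- (ln_exp (/ (1 + t) - 1)). apply ln_le; [apply Rinv_0_lt_compat; lra |].
        pose proof (exp_ineq1_le (/ (1 + t) - 1)); lra. }
      assert (/ (1 + t) <= 1 - t + t ^ 2)%R; [| lra].
      apply Rmult_le_reg_r with (1 + t)%R; [lra |]. rewrite Rinv_l by lra. nra.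
    - unfold L. rewrite <- (ln_exp t) at 2. apply ln_le; [lra | apply exp_ineq1_le]. }
  assert (HL0 : (0 <= L)%R) by (unfold L; rewrite <- ln_1; apply ln_le; lra).
  assert (Hz0 := Cmod_ge_0 z).
  assert (HwE : (Cmod (z * L) = Cmod z * L)%R) by (rewrite Cmod_mult, Cmod_R, Rabs_pos_eq; trivial).
  assert (Hw := cexp_linear (z * L)).
  rewrite HwE in Hw. specialize (Hw ltac:(nra)).
  replace (Rpow_C (1 + t) z)
    with (RtoC (exp (Re (z * L))) * (cos (Im (z * L)), sin (Im (z * L)))).
  2: { unfold Rpow_C; fold L; now rewrite re_scal_r, im_scal_r. }
  set (W := RtoC _ * _) in *.
  replace (W - (1 + z * t)) with ((W - (1 + z * L)) + z * (L - t)) by ring.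
  eapply Rle_trans; [apply Cmod_triangle |].
  rewrite Cmod_mult, <- RtoC_minus, Cmod_R.
  assert (Rabs (L - t) <= t ^ 2)%R by (apply Rabs_le; lra).
  assert ((Cmod z * L) ^ 2 <= Cmod z ^ 2 * t ^ 2)%R.
  { rewrite Rpow_mult_distr. apply Rmult_le_compat_l; [apply pow2_ge_0 |]. apply pow_incr; lra. }
  nra.
Qed.

Lemma Gauss_seq_nonzero z m : nonpole z -> Gauss_seq z m <> 0.
Proof.
  intros H; unfold Gauss_seq, Cdiv. apply Cmult_neq_0; [apply Cmult_neq_0 |].
  - apply CINR_fact_nonzero.
  - apply Rpow_C_nonzero.
  - intros E. apply C1_nz. rewrite <- (Cinv_r (rising z (S m))), E by now apply rising_nonzero. ring.
Qed.

(** The reciprocal of Gauss's product is used because its successive ratio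
    (1 + 1/m)^(-z) (1 + z/(m+1)) involves no division by an expression in z. *)
Lemma Gauss_seq_ratio z m : nonpole z -> (0 < m)%nat ->
  / Gauss_seq z (S m) =
  / Gauss_seq z m * (Rpow_C (1 + / INR m) (- z) * (1 + z * (/ INR (S m))%R)).
Proof.
  intros Hz Hm.
  assert (Hm' : (0 < INR m)%R) by now apply lt_0_INR.
  unfold Gauss_seq.
  replace (INR (S m)) with (INR m * (1 + / INR m))%R at 1 by (rewrite S_INR; field; lra).
  rewrite Rpow_C_mult by (pose proof (Rinv_0_lt_compat _ Hm'); lra).
  assert (HW : Rpow_C (1 + / INR m) (- z) = / Rpow_C (1 + / INR m) z).
  { rewrite <- (Cmult_1_r (/ _)), <- (Rpow_C_opp (1 + / INR m) z), Cmult_assoc, Cinv_l by apply Rpow_C_nonzero. ring. }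
  rewrite HW, RtoC_inv by (apply not_0_INR; lia).
  change (fact (S m)) with (S m * fact m)%nat. rewrite mult_INR, RtoC_mult.
  change (rising z (S (S m))) with (rising z (S m) * (z + INR (S m))).
  assert (E1 := rising_nonzero z (S m) Hz). assert (E2 := nonpole_add z (S m) Hz).
  assert (E3 := CINR_S_nonzero m). assert (E4 := Rpow_C_nonzero (INR m) z).
  assert (E5 := Rpow_C_nonzero (1 + / INR m) z).
  assert (E6 : RtoC (INR (fact m)) <> 0) by apply CINR_fact_nonzero.
  set (a := rising z (S m)) in *. set (k := RtoC (INR (S m))) in *.
  set (u := Rpow_C (INR m) z) in *. set (v := Rpow_C (1 + / INR m) z) in *.
  set (f := RtoC (INR (fact m))) in *. clearbody a k u v f.
  field; repeat split; assumption.
Qed.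

(** In the product of 1 - z/m + O(1/m^2) and 1 + z/(m+1) the terms of first order
    leave z (1/(m+1) - 1/m) = O(1/m^2).  The bound is written as a telescoping
    difference to fit [product_cv]. *)
Lemma Gauss_ratio_bound z : exists c : R, (0 <= c)%R /\ exists M : nat, (0 < M)%nat /\
  forall m, (M <= m)%nat ->
  (Cmod (Rpow_C (1 + / INR m) (- z) * (1 + z * (/ INR (S m))%R) - 1)
    <= c * (/ INR m - / INR (S m)))%R.
Proof.
  assert (Hz := Cmod_ge_0 z). set (r := Cmod z) in *.
  set (K := (8 * r ^ 2 + r)%R).
  exists (2 * (K * (1 + r) + r + r ^ 2))%R; split; [unfold K; nra |].
  (* From here on Cmod z / m <= 1/2, as [Rpow_C_linear] requires. *)
  destruct (INR_unbounded (2 * r + 1)) as [M HM].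
  exists (S M); split; [lia |]. intros m Hm.
  assert (HmM : (INR M <= INR m)%R) by (apply le_INR; lia).
  set (t := (/ INR m)%R). set (s := (/ INR (S m))%R).
  assert (Hm0 : (0 < INR m)%R) by lra.
  assert (Ht : (0 < t)%R) by now apply Rinv_0_lt_compat.
  assert (Ht1 : (t <= 1)%R) by (unfold t; rewrite <- Rinv_1; apply Rinv_le_contravar; lra).
  assert (Hs : (0 < s)%R) by (apply Rinv_0_lt_compat; rewrite S_INR; lra).
  assert (Hts : (t - s = t * s)%R) by (unfold t, s; rewrite S_INR; field; lra).
  assert (Hst : (t <= 2 * s)%R).
  { assert (E : (t = s + t * s)%R) by lra. nra. }
  assert (Hrt : (r * t <= / 2)%R).
  { apply Rmult_le_reg_r with (INR m); [lra |]. unfold t. rewrite Rmult_assoc, Rinv_l by lra. lra. }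
  assert (HE := Rpow_C_linear (- z) t Ht).
  rewrite Cmod_opp in HE. specialize (HE Hrt). fold r in HE. fold K in HE.
  set (W := Rpow_C (1 + t) (- z)) in *.
  replace (W * (1 + z * s) - 1)
    with ((W - (1 + - z * t)) * (1 + z * s) + (- z * (t * s)%R - z * z * (t * s)%R)).
  2: { rewrite <- Hts at 1. rewrite RtoC_mult, RtoC_minus; ring. }
  eapply Rle_trans; [apply Cmod_triangle |].
  assert (H1 : (Cmod (1 + z * s) <= 1 + r)%R).
  { eapply Rle_trans; [apply Cmod_triangle |]. rewrite Cmod_1, Cmod_mult, Cmod_R, Rabs_pos_eq by lra. fold r. nra. }
  assert (H2 : (Cmod (- z * (t * s)%R - z * z * (t * s)%R) <= (r + r ^ 2) * (t * s))%R).
  { eapply Rle_trans; [apply Cmod_triangle |]. rewrite Cmod_opp, !Cmod_mult, Cmod_opp, Cmod_R, Rabs_pos_eq by nra. fold r. nra. }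
  rewrite Cmod_mult, Hts.
  assert (HK : (0 <= K)%R) by (unfold K; nra).
  assert (Htt : (t ^ 2 <= 2 * (t * s))%R) by nra.
  assert (H3 : (Cmod (W - (1 + - z * t)) * Cmod (1 + z * s) <= (K * (2 * (t * s))) * (1 + r))%R).
  { apply Rmult_le_compat; try apply Cmod_ge_0; [| exact H1].
    eapply Rle_trans; [exact HE |]. now apply Rmult_le_compat_l. }
  nra.
Qed.

Lemma Gauss_seq_cv z : nonpole z -> exists l : C, l <> 0 /\ Clim (Gauss_seq z) l.
Proof.
  intros Hz.
  destruct (Gauss_ratio_bound z) as (c & Hc & M & HM & Hb).
  (* The index shift also makes c / m <= 1/2, for [product_cv_nonzero]. *)
  destruct (INR_unbounded (2 * c)) as [M' HM'].
  set (P := (M + M')%nat).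
  destruct (product_cv_nonzero (fun n => / Gauss_seq z (n + P)) (fun n => c * / INR (n + P))%R)
    as [l [Hl1 Hl2]].
  - intros n.
    assert (INR M' <= INR (n + P))%R by (apply le_INR; unfold P; lia).
    assert (0 < INR (n + P))%R by lra.
    split; [apply Rmult_le_pos; [lra | left; now apply Rinv_0_lt_compat] |].
    apply Rmult_le_reg_r with (INR (n + P)); [lra |]. rewrite Rmult_assoc, Rinv_l by lra. lra.
  - intros n. apply Rmult_le_compat_l; [lra |]. apply Rinv_le_contravar; [| apply le_INR; lia].
    apply lt_0_INR; unfold P; lia.
  - intros n. change (S n + P)%nat with (S (n + P)).
    rewrite Gauss_seq_ratio by (trivial; unfold P; lia).
    set (G := / Gauss_seq z (n + P)). set (q := Rpow_C _ _ * _).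
    replace (G * q - G) with (G * (q - 1)) by ring.
    rewrite Cmod_mult, <- Rmult_minus_distr_l, Rmult_comm.
    apply Rmult_le_compat_r; [apply Cmod_ge_0 |].
    apply Hb; unfold P; lia.
  - intros n E. apply C1_nz.
    rewrite <- (Cinv_l (Gauss_seq z (n + P))), E by now apply Gauss_seq_nonzero. ring.
  - exists l; split; [exact Hl1 |].
    apply (Clim_shift _ P). apply Clim_ext_loc with (2 := Hl2).
    exists O; intros n _. field. now apply Gauss_seq_nonzero.
Qed.

Lemma Clim_CGamma z l : Clim (Gauss_seq z) l -> CGamma z = l.
Proof.
  intros [H1 H2]; unfold CGamma.
  rewrite (is_lim_seq_unique _ _ H1), (is_lim_seq_unique _ _ H2). now destruct l.
Qed.

Lemma CGamma_spec z : nonpole z -> CGamma z <> 0 /\ Clim (Gauss_seq z) (CGamma z).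
Proof.
  intros Hz; destruct (Gauss_seq_cv z Hz) as [l [Hl1 Hl2]].
  now rewrite (Clim_CGamma z l Hl2).
Qed.

Lemma nonpole_S z : nonpole z -> nonpole (z + 1).
Proof.
  intros H m E. apply (H (S m)). rewrite CINR_S.
  replace z with (z + 1 - 1) by ring. rewrite E; ring.
Qed.

Lemma Clim_one_plus_div (c : C) : Clim (fun m => 1 + c * (/ INR m)%R) 1.
Proof.
  assert (H : is_lim_seq (fun m => / INR m)%R 0%R).
  { apply (is_lim_seq_inv INR p_infty); [apply is_lim_seq_INR | easy]. }
  split.
  - apply is_lim_seq_ext with (fun m => 1 + Re c * / INR m)%R.
    { intros n; simpl; unfold Re; ring. }
    replace (Re 1) with (1 + Re c * 0)%R by (simpl; ring).
    apply is_lim_seq_plus'; [apply is_lim_seq_const |].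
    apply is_lim_seq_mult'; [apply is_lim_seq_const | exact H].
  - apply is_lim_seq_ext with (fun m => Im c * / INR m)%R.
    { intros n; simpl; unfold Im; ring. }
    replace (Im 1) with (Im c * 0)%R by (simpl; ring).
    apply is_lim_seq_mult'; [apply is_lim_seq_const | exact H].
Qed.

(** Gauss_seq (z + 1) m and z * Gauss_seq z m differ by the factor
    1 + (z + 1) / m, which tends to 1. *)
Lemma CGamma_S z : nonpole z -> CGamma (z + 1) = z * CGamma z.
Proof.
  intros Hz.
  destruct (CGamma_spec z Hz) as [_ H0].
  destruct (CGamma_spec (z + 1) (nonpole_S z Hz)) as [_ H1].
  rewrite <- (Cmult_1_r (CGamma (z + 1))).
  apply (Clim_unique (fun m => Gauss_seq (z + 1) m * (1 + (z + 1) * (/ INR m)%R))).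
  - apply Clim_mult; [exact H1 | apply Clim_one_plus_div].
  - apply Clim_ext_loc with (fun m => z * Gauss_seq z m).
    2: apply Clim_mult; [apply Clim_const | exact H0].
    exists 1%nat; intros m Hm.
    assert (Hm' : (0 < INR m)%R) by (apply lt_0_INR; lia).
    unfold Gauss_seq. rewrite Rpow_C_plus, Rpow_C_1, RtoC_inv by lra.
    change (rising (z + 1) (S m)) with (rising (z + 1) m * (z + 1 + INR m)).
    rewrite rising_head.
    assert (E1 := rising_nonzero (z + 1) m (nonpole_S z Hz)).
    assert (E2 := nonpole_add (z + 1) m (nonpole_S z Hz)).
    assert (E3 : z <> 0) by (intros E; apply (Hz O); rewrite E; simpl; ring).
    assert (E4 : RtoC (INR m) <> 0) by (intros E; apply RtoC_inj in E; lra).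
    set (a := rising (z + 1) m) in *. set (k := RtoC (INR m)) in *.
    set (f := RtoC (INR (fact m))). set (u := Rpow_C _ _). clearbody a k f u.
    field; repeat split; assumption.
Qed.

Lemma CGamma_add z n : nonpole z -> CGamma (z + INR n) = rising z n * CGamma z.
Proof.
  intros Hz; induction n as [|n IH].
  - simpl. rewrite Cplus_0_r; ring.
  - rewrite CINR_S, Cplus_assoc, CGamma_S, IH; [simpl; ring |].
    clear IH; induction n as [|n IH]; [simpl; now rewrite Cplus_0_r |].
    rewrite CINR_S, Cplus_assoc; now apply nonpole_S.
Qed.

Lemma nonpole_Re_pos z : (0 < Re z)%R -> nonpole z.
Proof.
  intros H m E. rewrite E in H; simpl in H. pose proof (pos_INR m); lra.
Qed.

Lemma rising_1 n : rising 1 n = INR (fact n).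
Proof.
  induction n as [|n IH]; [reflexivity |].
  simpl rising. rewrite IH. change (fact (S n)) with (S n * fact n)%nat.
  rewrite mult_INR, RtoC_mult, CINR_S; ring.
Qed.

Lemma CGamma_1 : CGamma 1 = 1.
Proof.
  assert (H1 : nonpole 1) by (apply nonpole_Re_pos; simpl; lra).
  destruct (CGamma_spec 1 H1) as [_ H].
  apply (Clim_unique (fun m => Gauss_seq 1 m * (1 + 1 * (/ INR m)%R))).
  - rewrite <- (Cmult_1_r (CGamma 1)). apply Clim_mult; [exact H | apply Clim_one_plus_div].
  - apply Clim_ext_loc with (fun _ => RtoC 1); [| apply Clim_const].
    exists 1%nat; intros m Hm.
    assert (Hm' : (0 < INR m)%R) by (apply lt_0_INR; lia).
    unfold Gauss_seq. rewrite Rpow_C_1, RtoC_inv by lra.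
    change (rising 1 (S m)) with (rising 1 m * (1 + INR m)). rewrite rising_1.
    assert (E4 : RtoC (INR m) <> 0) by (intros E; apply RtoC_inj in E; lra).
    assert (E2 := nonpole_add 1 m H1).
    assert (E6 : RtoC (INR (fact m)) <> 0) by apply CINR_fact_nonzero.
    field; repeat split; assumption.
Qed.

Lemma CGamma_fact n : CGamma (INR n + 1) = INR (fact n).
Proof.
  rewrite Cplus_comm, CGamma_add, rising_1, CGamma_1 by (apply nonpole_Re_pos; simpl; lra). ring.
Qed.

Lemma Cinv_0 : / RtoC 0 = 0.
Proof.
  unfold Cinv, RtoC; simpl. f_equal; unfold Rdiv; ring.
Qed.

(** At a pole the rising factorial in Gauss's product eventually vanishes, and the
    total inverse sends 0 to 0. *)
Lemma CGamma_pole m : CGamma (- INR m) = 0.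
Proof.
  apply Clim_CGamma.
  apply Clim_ext_loc with (fun _ => RtoC 0); [| apply Clim_const].
  exists m; intros n Hn. unfold Gauss_seq, Cdiv.
  replace (rising (- INR m) (S n)) with (RtoC 0); [rewrite Cinv_0; ring |].
  induction Hn as [|n Hn IH].
  - simpl; ring.
  - change (rising (- INR m) (S (S n))) with (rising (- INR m) (S n) * (- INR m + INR (S n))).
    rewrite <- IH; ring.
Qed.

(** * Finite sums of complex numbers *)

(** Sums live in the carrier of [C_AbelianMonoid]; the equality has to be restated
    in [C] before [ring] recognises it. *)
Ltac Cring := lazymatch goal with |- ?a = ?b => change (@eq C a b) end; ring.

Lemma sum_n_Cext (u v : nat -> C) n :
  (forall i, (i <= n)%nat -> u i = v i) -> sum_n u n = sum_n v n.
Proof. exact (sum_n_ext_loc u v n). Qed.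

Lemma sum_n_CS (u : nat -> C) n : sum_n u (S n) = sum_n u n + u (S n).
Proof. exact (sum_Sn u n). Qed.

Lemma sum_n_Cminus (u v : nat -> C) n : sum_n (fun i => u i - v i) n = sum_n u n - sum_n v n.
Proof.
  induction n as [|n IH]; [now rewrite !sum_O |].
  rewrite !sum_n_CS, IH; Cring.
Qed.

Lemma sum_n_Cmult_l (c : C) (u : nat -> C) n : sum_n (fun i => c * u i) n = c * sum_n u n.
Proof. apply (sum_n_mult_l c u n). Qed.

Lemma sum_n_rev (u : nat -> C) n : sum_n (fun i => u (n - i)%nat) n = sum_n u n.
Proof.
  revert u; induction n as [|n IH]; intros u; [now rewrite !sum_O |].
  rewrite sum_Sn, Nat.sub_diag.
  rewrite (sum_n_Cext _ (fun i => u (S (n - i)))) by (intros; f_equal; lia).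
  rewrite (IH (fun i => u (S i))).
  unfold sum_n at 2. rewrite (sum_Sn_m u 0) by lia.
  rewrite <- sum_n_m_S, plus_comm. reflexivity.
Qed.

(** * The fractional difference as a convolution *)

(** The coefficient of u^j in the power series of (1 - u)^(-a). *)
Definition neg_binom_coeff (a : C) (j : nat) : C := rising a j / INR (fact j).

(** Coefficient form of (1 - u) (1 - u)^(-a) = (1 - u)^(-(a - 1)). *)
Lemma neg_binom_coeff_pascal a j :
  neg_binom_coeff a (S j) - neg_binom_coeff a j = neg_binom_coeff (a - 1) (S j).
Proof.
  unfold neg_binom_coeff.
  rewrite (rising_head (a - 1)). replace (a - 1 + 1) with a by ring.
  change (rising a (S j)) with (rising a j * (a + INR j)).
  change (fact (S j)) with (S j * fact j)%nat. rewrite mult_INR, RtoC_mult.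
  assert (E := CINR_fact_nonzero j). assert (E' := CINR_S_nonzero j).
  rewrite CINR_S in *. field. now split.
Qed.

Definition neg_binom_conv (a : C) (b : Z) (f : Z -> C) (t : Z) : C :=
  sumZ b t (fun k => neg_binom_coeff a (Z.to_nat (t - k)) * f k).

Lemma sumZ_nat b n F : sumZ b (b + Z.of_nat n) F = sum_n (fun i => F (b + Z.of_nat i)%Z) n.
Proof.
  unfold sumZ. destruct (Z_lt_dec _ _) as [H|_]; [lia |].
  f_equal; lia.
Qed.

Lemma sumZ_empty b t F : (t < b)%Z -> sumZ b t F = 0.
Proof. intros H; unfold sumZ. destruct (Z_lt_dec _ _); [reflexivity | lia]. Qed.

Lemma neg_binom_conv_nat a b f n :
  neg_binom_conv a b f (b + Z.of_nat n) =
  sum_n (fun i => neg_binom_coeff a (n - i) * f (b + Z.of_nat i)%Z) n.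
Proof.
  unfold neg_binom_conv. rewrite sumZ_nat. apply sum_n_Cext; intros i Hi.
  do 2 f_equal; lia.
Qed.

Lemma neg_binom_coeff_0 a : neg_binom_coeff a 0 = 1.
Proof. unfold neg_binom_coeff; simpl; field; apply C1_nz. Qed.

(** On generating functions the backward difference is multiplication by 1 - u, and
    a convolution with [neg_binom_coeff a] is multiplication by (1 - u)^(-a). *)
Lemma nabla_neg_binom_conv a b f t :
  nabla (neg_binom_conv a b f) t = neg_binom_conv (a - 1) b f t.
Proof.
  unfold nabla.
  destruct (Z_lt_dec t b) as [Ht|Ht].
  - unfold neg_binom_conv. rewrite !sumZ_empty by lia. ring.
  - replace t with (b + Z.of_nat (Z.to_nat (t - b)))%Z by lia.
    set (n := Z.to_nat (t - b)). clearbody n.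
    destruct n as [|n].
    + replace (neg_binom_conv a b f (b + Z.of_nat 0 - 1)) with (RtoC 0)
        by (symmetry; apply sumZ_empty; lia).
      rewrite !neg_binom_conv_nat, !sum_O, !neg_binom_coeff_0. Cring.
    + replace (b + Z.of_nat (S n) - 1)%Z with (b + Z.of_nat n)%Z by lia.
      rewrite !neg_binom_conv_nat, !sum_n_CS, !Nat.sub_diag, !neg_binom_coeff_0.
      set (F := fun i => neg_binom_coeff a (S n - i) * f (b + Z.of_nat i)%Z).
      set (G := fun i => neg_binom_coeff a (n - i) * f (b + Z.of_nat i)%Z).
      replace (sum_n (fun i => neg_binom_coeff (a - 1) (S n - i) * f (b + Z.of_nat i)%Z) n)
        with (sum_n F n - sum_n G n).
      * Cring.
      * rewrite <- sum_n_Cminus. apply sum_n_Cext; intros i Hi.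
        unfold F, G. replace (S n - i)%nat with (S (n - i)) by lia.
        rewrite <- neg_binom_coeff_pascal; ring.
Qed.

Lemma iter_nabla_neg_binom_conv n c a b f g :
  (forall t, g t = c * neg_binom_conv a b f t) ->
  forall t, Nat.iter n nabla g t = c * neg_binom_conv (a - INR n) b f t.
Proof.
  intros Hg; induction n as [|n IH]; intros t.
  - simpl. rewrite Hg. do 2 f_equal; ring.
  - change (nabla (Nat.iter n nabla g) t = c * neg_binom_conv (a - INR (S n)) b f t).
    unfold nabla. rewrite !IH.
    replace (a - INR (S n)) with (a - INR n - 1) by (rewrite CINR_S; ring).
    rewrite <- nabla_neg_binom_conv; unfold nabla; ring.
Qed.

Lemma diff_order_pos mu : (0 < Re (INR (diff_order mu) - mu))%R.
Proof.
  simpl. unfold diff_order. rewrite INR_IZR_INZ.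
  destruct (archimed (Re mu)) as [H _].
  assert (IZR (up (Re mu)) <= IZR (Z.of_nat (Z.to_nat (up (Re mu)))))%R by (apply IZR_le; lia).
  unfold Re in *; lra.
Qed.

(** The ratio Gamma(a + j) / Gamma(j + 1) is Gamma(a) (a)_j / j!: this identifies
    the kernel of the fractional difference, up to the normalising constant. *)
Lemma risingC_kernel a j : nonpole a ->
  risingC (INR j + 1) (a - 1) = CGamma a * neg_binom_coeff a j.
Proof.
  intros Ha; unfold risingC, neg_binom_coeff.
  replace (INR j + 1 + (a - 1)) with (a + INR j) by ring.
  rewrite CGamma_add, CGamma_fact by assumption. unfold Cdiv; ring.
Qed.

Lemma sumZ_ext b t F G : (forall k, (b <= k <= t)%Z -> F k = G k) -> sumZ b t F = sumZ b t G.
Proof.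
  intros H; unfold sumZ; destruct (Z_lt_dec t b); [reflexivity |].
  apply sum_n_Cext; intros i Hi; apply H; lia.
Qed.

Lemma sumZ_Cmult_l c b t F : sumZ b t (fun k => c * F k) = c * sumZ b t F.
Proof.
  unfold sumZ; destruct (Z_lt_dec t b); [ring | apply sum_n_Cmult_l].
Qed.

(** The fractional sum has exponent n - mu, and each of the n differences lowers it
    by one: the truncation order n disappears from the result. *)
Lemma frac_diff_neg_binom_conv mu b f t : frac_diff mu b f t = neg_binom_conv (- mu) b f t.
Proof.
  unfold frac_diff; cbv zeta.
  assert (Hn := nonpole_Re_pos _ (diff_order_pos mu)).
  set (n := diff_order mu) in *.
  rewrite (iter_nabla_neg_binom_conv n (CGamma (INR n - mu)) (INR n - mu) b f).
  - replace (INR n - mu - INR n) with (- mu) by ring.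
    rewrite Cmult_assoc, Cinv_l, Cmult_1_l; [reflexivity |]. now apply CGamma_spec.
  - intros s; unfold neg_binom_conv. rewrite <- sumZ_Cmult_l.
    apply sumZ_ext; intros k Hk.
    replace (RtoC (IZR (s - k + 1))) with (INR (Z.to_nat (s - k)) + 1).
    2: { rewrite <- RtoC_plus, INR_IZR_INZ, <- plus_IZR. do 2 f_equal; lia. }
    rewrite risingC_kernel by exact Hn. ring.
Qed.

(** Valid also at 0, where the total inverse is 0. *)
Lemma Cinv_mult (a b : C) : / (a * b) = / a * / b.
Proof.
  destruct (Req_dec (Cmod a) 0) as [Ha|Ha].
  { apply Cmod_eq_0 in Ha; subst; rewrite Cmult_0_l, Cinv_0; ring. }
  destruct (Req_dec (Cmod b) 0) as [Hb|Hb].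
  { apply Cmod_eq_0 in Hb; subst; rewrite Cmult_0_r, Cinv_0; ring. }
  field; split; intros E; subst; rewrite Cmod_0 in *; lra.
Qed.

(** * The polynomial form of the Krawtchouk function *)

(** The common value of both sides of the theorem.  It is a polynomial in [nu], so it
    also makes sense at the orders where the hypergeometric form is singular. *)
Definition krawtchouk_poly (p : C) (N x : nat) (nu : C) : C :=
  / Cbinom (INR N) x *
  sum_n (fun j => neg_binom_coeff (- nu) j * Cbinom (INR N - nu) (x - j) * ((1 - p) / p) ^ j) x.

Lemma Cdiv_nonzero (a b : C) : a <> 0 -> b <> 0 -> a / b <> 0.
Proof.
  intros Ha Hb E. apply Ha. rewrite <- (Cmult_1_r a), <- (Cinv_l b Hb), Cmult_assoc.
  fold (a / b). rewrite E; ring.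
Qed.

Lemma frac_krawtchouk_poly (p : C) N mu x : p <> 0 -> p <> 1 ->
  frac_krawtchouk mu x p N = krawtchouk_poly p N x mu.
Proof.
  intros hp0 hp1. assert (hp1' : 1 - p <> 0) by (apply Cminus_eq_contra; auto).
  unfold frac_krawtchouk, krawtchouk_poly.
  rewrite frac_diff_neg_binom_conv.
  change (Z.of_nat x) with (0 + Z.of_nat x)%Z at 1. rewrite neg_binom_conv_nat.
  rewrite <- sum_n_rev.
  assert (Hq := Cdiv_nonzero _ _ hp0 hp1').
  replace ((1 - p) / p) with (/ (p / (1 - p))) by (field; now split).
  set (q := p / (1 - p)) in *. clearbody q.
  rewrite Cinv_mult, <- Cmult_assoc. f_equal.
  rewrite <- sum_n_Cmult_l. apply sum_n_Cext; intros j Hj.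
  rewrite Z.add_0_l, Nat2Z.id. replace (x - (x - j))%nat with j by lia.
  rewrite Cpow_inv by exact Hq.
  replace (q ^ x) with (q ^ (x - j) * q ^ j) by (rewrite <- Cpow_add_r; f_equal; lia).
  assert (E1 := Cpow_nz q j Hq). assert (E2 := Cpow_nz q (x - j) Hq).
  field; now split.
Qed.

Lemma rising_add z m n : rising z (m + n) = rising z m * rising (z + INR m) n.
Proof.
  induction n as [|n IH].
  - rewrite Nat.add_0_r; simpl; ring.
  - rewrite Nat.add_succ_r. simpl rising. rewrite IH, plus_INR, RtoC_plus. ring.
Qed.

Lemma falling_rising z k : falling z k = rising (z - INR k + 1) k.
Proof.
  induction k as [|k IH]; [reflexivity |].
  rewrite rising_head. simpl falling. rewrite IH, CINR_S.
  replace (z - (INR k + 1) + 1 + 1) with (z - INR k + 1) by ring. ring.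
Qed.

Lemma rising_opp z j : rising (- z) j = (- (1)) ^ j * falling z j.
Proof.
  induction j as [|j IH]; [simpl; ring |].
  rewrite Cpow_S; simpl rising; simpl falling; rewrite IH; ring.
Qed.

Lemma falling_fact n k : (k <= n)%nat -> falling (INR n) k * INR (fact (n - k)) = INR (fact n).
Proof.
  induction k as [|k IH]; intros Hk.
  - rewrite Nat.sub_0_r; simpl; ring.
  - rewrite <- IH by lia. simpl falling.
    replace (n - k)%nat with (S (n - S k)) by lia.
    change (fact (S (n - S k))) with (S (n - S k) * fact (n - S k))%nat.
    rewrite mult_INR, RtoC_mult.
    replace (S (n - S k)) with (n - k)%nat by lia. rewrite minus_INR, RtoC_minus by lia. ring.
Qed.

Lemma falling_big n k : (n < k)%nat -> falling (INR n) k = 0.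
Proof.
  induction 1 as [|k _ IH]; simpl falling; [ring | rewrite IH; ring].
Qed.

Definition krawtchouk_hyp (p : C) (N x : nat) (nu : C) : C :=
    CGamma (INR N - INR x + 1) * CGamma (INR N - nu + 1)
    / (CGamma (INR N + 1) * CGamma (INR N - nu - INR x + 1))
    * sum_n (fun j : nat =>
        rising (- nu) j * rising (- INR x) j
        / (INR (fact j) * rising (INR N - nu - INR x + 1) j)
        * (1 - 1 / p) ^ j) x.

(** Put w = N - nu - x + 1.  The Gamma quotient in [nu] is (w)_x, which splits as
    (w)_j (w + j)_(x-j), and (w + j)_(x-j) is the falling factorial of N - nu of
    length x - j; the remaining factorials form the two binomial coefficients.
    For x > N both sides are 0: on the left Gamma(N - x + 1) is taken at a pole,
    on the right binom(N, x) = 0 is inverted. *)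
Lemma krawtchouk_hyp_poly (p : C) N x nu : p <> 0 -> nonpole (INR N - nu - INR x + 1) ->
  krawtchouk_hyp p N x nu = krawtchouk_poly p N x nu.
Proof.
  intros hp0 Hw. unfold krawtchouk_hyp, krawtchouk_poly.
  destruct (le_lt_dec x N) as [Hx|Hx].
  2: { unfold Cbinom at 1. rewrite falling_big by exact Hx.
       replace (RtoC (INR N) - INR x + 1) with (- RtoC (INR (x - S N))).
       2: { rewrite minus_INR, RtoC_minus, CINR_S by lia; ring. }
       rewrite CGamma_pole. unfold Cdiv. rewrite !Cmult_0_l, Cinv_0; ring. }
  replace (INR N - nu + 1) with (INR N - nu - INR x + 1 + INR x) by ring.
  rewrite CGamma_add by exact Hw.
  rewrite CGamma_fact.
  replace (RtoC (INR N) - INR x) with (RtoC (INR (N - x))) by (rewrite minus_INR, RtoC_minus by lia; ring).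
  rewrite CGamma_fact.
  rewrite <- !sum_n_Cmult_l. apply sum_n_Cext; intros j Hj.
  unfold Cbinom at 2. rewrite (falling_rising (INR N - nu)).
  replace (INR N - nu - INR (x - j) + 1) with (INR N - nu - INR x + 1 + INR j)
    by (rewrite minus_INR, RtoC_minus by lia; ring).
  set (w := INR N - nu - INR x + 1) in *.
  replace (rising w x) with (rising w j * rising (w + INR j) (x - j))
    by (rewrite <- rising_add; f_equal; lia).
  rewrite (rising_opp (INR x)).
  replace (1 - 1 / p) with (- (1) * ((1 - p) / p)) by (field; exact hp0).
  rewrite Cpow_mult_l.
  (* One sign comes from (-x)_j, the other from 1 - 1/p = - (1 - p)/p. *)
  set (e := (- (1)) ^ j).
  assert (He : e * e = 1) by (unfold e; rewrite <- Cpow_mult_l;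
    replace (- (1) * - (1)) with (RtoC 1) by ring; apply Cpow_1_l).
  unfold Cbinom, neg_binom_coeff.
  assert (HNx := falling_fact N x Hx). assert (Hxj := falling_fact x j Hj).
  assert (E1 := CINR_fact_nonzero N). assert (E2 := CINR_fact_nonzero (N - x)).
  assert (E3 := CINR_fact_nonzero x). assert (E4 := CINR_fact_nonzero (x - j)).
  assert (E5 := CINR_fact_nonzero j). assert (E6 := rising_nonzero w j Hw).
  destruct (CGamma_spec w Hw) as [E7 _].
  rewrite <- HNx in E1 |- *. rewrite <- Hxj in E3 |- *.
  assert (E8 : falling (INR N) x <> 0) by (intros E; apply E1; rewrite E; ring).
  assert (E9 : falling (INR x) j <> 0) by (intros E; apply E3; rewrite E; ring).
  set (P := ((1 - p) / p) ^ j).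
  transitivity (e * e * (rising (w + INR j) (x - j) * falling (INR x) j * rising (- nu) j * P
    / (falling (INR N) x * INR (fact j)))); [| rewrite He]; field; repeat split; assumption.
Qed.

(** * Continuity in the order and removal of the singularities *)

(** The product is continuous for the topology of the absolute value on [C], which
    [locally_C] identifies with the product topology. *)
Lemma continuous_Cmult (f g : C -> C) (z : C) :
  continuous f z -> continuous g z -> continuous (fun y => f y * g y) z.
Proof.
  intros Hf Hg P HP. apply locally_C in HP.
  refine (continuous_mult (K := C_AbsRing) (U := C_UniformSpace) f g z _ _ P HP);
    intros Q HQ; apply locally_C in HQ; [exact (Hf Q HQ) | exact (Hg Q HQ)].
Qed.

Lemma continuous_Cplus (f g : C -> C) (z : C) :
  continuous f z -> continuous g z -> continuous (fun y => f y + g y) z.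
Proof. exact (continuous_plus (K := C_AbsRing) (V := C_NormedModule) f g z). Qed.

Lemma continuous_rising (g : C -> C) (z : C) j :
  continuous g z -> continuous (fun y => rising (g y) j) z.
Proof.
  intros Hg; induction j as [|j IH]; simpl; [apply continuous_const |].
  apply continuous_Cmult; [exact IH |].
  apply continuous_Cplus; [exact Hg | apply continuous_const].
Qed.

Lemma continuous_Copp (z : C) : continuous Copp z.
Proof. exact (continuous_opp (K := C_AbsRing) (V := C_NormedModule) (fun y => y) z (continuous_id z)). Qed.

Lemma continuous_sum_n (F : nat -> C -> C) (z : C) n :
  (forall j, continuous (F j) z) -> continuous (fun y => sum_n (fun j => F j y) n) z.
Proof.
  intros HF; induction n as [|n IH].
  - apply continuous_ext with (F O); [intros y; now rewrite sum_O | apply HF].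
  - apply continuous_ext with (fun y => sum_n (fun j => F j y) n + F (S n) y).
    + intros y; now rewrite sum_n_CS.
    + apply continuous_Cplus; [exact IH | apply HF].
Qed.

Lemma continuous_krawtchouk_poly (p : C) N x (mu : C) : continuous (krawtchouk_poly p N x) mu.
Proof.
  unfold krawtchouk_poly.
  apply continuous_Cmult; [apply continuous_const |].
  apply (continuous_sum_n (fun j nu => neg_binom_coeff (- nu) j * Cbinom (INR N - nu) (x - j) * ((1 - p) / p) ^ j)).
  intros j. apply continuous_Cmult; [| apply continuous_const].
  unfold neg_binom_coeff, Cbinom, Cdiv.
  apply continuous_Cmult; (apply continuous_Cmult; [| apply continuous_const]).
  - apply continuous_rising, continuous_Copp.
  - apply continuous_ext with (fun nu => rising (RtoC (INR N) + - nu + (1 - INR (x - j))) (x - j)).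
    + intros nu; rewrite falling_rising. f_equal; ring.
    + apply continuous_rising. apply continuous_Cplus; [| apply continuous_const].
      apply continuous_Cplus; [apply continuous_const | apply continuous_Copp].
Qed.

(** Poles are isolated: two of them differ by an integer, so one lying within
    distance less than 1 of another coincides with it. *)
Lemma nonpole_near (c mu : C) : (exists m : nat, c - mu = - INR m) ->
  locally' mu (fun nu => nonpole (c - nu)).
Proof.
  intros [m Hm]. exists (mkposreal 1 Rlt_0_1). intros nu [Hnu _] Hne k Hk.
  apply Hne.
  assert (E : nu - mu = INR k - INR m).
  { replace (nu - mu) with ((c - mu) - (c - nu)) by ring. rewrite Hm, Hk; ring. }
  assert (Ek : k = m).
  { change (Rabs (Re nu - Re mu) < 1)%R in Hnu.
    replace (Re nu - Re mu)%R with (Re (nu - mu)) in Hnu by reflexivity.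
    rewrite E, <- RtoC_minus in Hnu; simpl in Hnu.
    apply Rabs_def2 in Hnu. rewrite !INR_IZR_INZ, <- minus_IZR in Hnu.
    destruct Hnu as [H1 H2]. apply lt_IZR in H1. change (- (1))%R with (IZR (-1)) in H2.
    apply lt_IZR in H2. lia. }
  replace nu with (mu + (nu - mu)) by Cring. rewrite E, Ek; Cring.
Qed.

Theorem proposition3p23 (p : C) (N : nat) (mu : C) (x : nat)
  (hp0 : p <> 0) (hp1 : p <> 1) :
  let rhs (nu : C) : C :=
    CGamma (INR N - INR x + 1) * CGamma (INR N - nu + 1)
    / (CGamma (INR N + 1) * CGamma (INR N - nu - INR x + 1))
    * sum_n (fun j : nat =>
        rising (- nu) j * rising (- INR x) j
        / (INR (fact j) * rising (INR N - nu - INR x + 1) j)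
        * (1 - 1 / p) ^ j) x in
  ((forall m : nat, INR N - mu - INR x + 1 <> - INR m) ->
     frac_krawtchouk mu x p N = rhs mu) /\
  ((exists m : nat, INR N - mu - INR x + 1 = - INR m) ->
     filterlim rhs (locally' mu) (locally (frac_krawtchouk mu x p N))).
Proof.
  intros rhs. rewrite (frac_krawtchouk_poly p N mu x hp0 hp1).
  assert (Hrhs : forall nu, nonpole (INR N - nu - INR x + 1) -> krawtchouk_poly p N x nu = rhs nu).
  { intros nu Hnu; symmetry; exact (krawtchouk_hyp_poly p N x nu hp0 Hnu). }
  split; [exact (Hrhs mu) |].
  intros [m Hm].
  apply filterlim_ext_loc with (krawtchouk_poly p N x).
  - generalize (nonpole_near (INR N - INR x + 1) mu).
    intros H. apply filter_imp with (2 := H ltac:(exists m; rewrite <- Hm; ring)).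
    intros nu Hnu. apply Hrhs. replace (INR N - nu - INR x + 1) with (INR N - INR x + 1 - nu) by ring. exact Hnu.
  - intros P HP. apply filter_le_within.
    exact (continuous_krawtchouk_poly p N x mu P HP).
Qed.
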